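(* Let $0<q<1$, $\beta>0$, $g(t)=t^{\beta-1}$, and $f(t)=\sum_ia_it^{\alpha_i}$ with real coefficients $a_i$ and real exponents $\alpha_i>0$. Then $$L_q(f*g)(s)=L_q(f)(s)\,L_q(g)(s),$$ for $s>0$ restricted so that the transforms involved converge, where $(f*g)(t)=\int_0^tf(\tau)\,(t-q\tau)_q^{\beta-1}\,d_q\tau$.
   Context: Fix $0<q<1$. $[n]_q=\frac{1-q^n}{1-q}$, $[n]_q!=[n]_q\cdots[1]_q$, $[0]_q!=1$, $E_q(z)=\sum_{n\ge0}\frac{q^{\binom n2}z^n}{[n]_q!}$, $(x;q)_\infty=\prod_{i\ge0}(1-xq^i)$. Finite Jackson integral: $\int_0^xf(t)\,d_qt=(1-q)\sum_{k\ge0}f(q^kx)xq^k$. Improper Jackson integral: $\int_0^\infty f(x)\,d_qx=(1-q)\sum_{n\in\mathbb{Z}}q^nf(q^n)$. $L_q(f(t))(s)=\int_0^\infty E_q(-qst)f(t)\,d_qt$ ($s>0$). For $t>0$ and real $\gamma$, $(t-q\tau)_q^{\gamma}=t^{\gamma}\frac{(q\tau/t;q)_\infty}{(q^{\gamma+1}\tau/t;q)_\infty}$, which for $\gamma\in\mathbb{N}$ equals $\prod_{j=0}^{\gamma-1}(t-q^{j+1}\tau)$. The $q$-convolution of $f$ with $g(t)=t^{\beta-1}$ is $(f*g)(t)=\int_0^tf(\tau)(t-q\tau)_q^{\beta-1}\,d_q\tau$. *)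

(* Defs.v *)
From Stdlib Require Import Reals ZArith.
From Coquelicot Require Import Coquelicot.
Open Scope R_scope.

Definition q_number (q : R) (n : nat) : R := (1 - q ^ n) / (1 - q).

Fixpoint q_factorial (q : R) (n : nat) : R :=
  match n with
  | O => 1
  | S m => q_number q (S m) * q_factorial q m
  end.

(* [n * (n - 1) / 2] in [nat] is the binomial coefficient; Stdlib's real-valued
   [C n 2] does not vanish for [n < 2]. *)
Definition q_exp (q z : R) : R :=
  Series (fun n : nat => q ^ (n * (n - 1) / 2)%nat * z ^ n / q_factorial q n).

(* The infinite product converges for every [x] as soon as [0 < q < 1]. *)
Definition q_poch_inf (q x : R) : R :=
  real (Lim_seq (fun n : nat => prod_f_R0 (fun i : nat => 1 - x * q ^ i) n)).

Definition jackson_int (q : R) (f : R -> R) (x : R) : R :=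
  (1 - q) * Series (fun k : nat => f (q ^ k * x) * x * q ^ k).

(* A bilateral series converges when its two halves [n >= 0] and [n <= -1] both
   do (not necessarily absolutely). *)
Definition ex_bilateral_series (h : Z -> R) : Prop :=
  ex_series (fun n : nat => h (Z.of_nat n)) /\
  ex_series (fun n : nat => h (- Z.of_nat (S n))%Z).

Definition bilateral_series (h : Z -> R) : R :=
  Series (fun n : nat => h (Z.of_nat n)) +
  Series (fun n : nat => h (- Z.of_nat (S n))%Z).

Definition jackson_improper_term (q : R) (f : R -> R) (n : Z) : R :=
  powerRZ q n * f (powerRZ q n).

Definition ex_jackson_improper (q : R) (f : R -> R) : Prop :=
  ex_bilateral_series (jackson_improper_term q f).

Definition jackson_improper (q : R) (f : R -> R) : R :=
  (1 - q) * bilateral_series (jackson_improper_term q f).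

Definition q_laplace_integrand (q : R) (f : R -> R) (s t : R) : R :=
  q_exp q (- (q * s * t)) * f t.

Definition ex_q_laplace (q : R) (f : R -> R) (s : R) : Prop :=
  ex_jackson_improper q (q_laplace_integrand q f s).

Definition q_laplace (q : R) (f : R -> R) (s : R) : R :=
  jackson_improper q (q_laplace_integrand q f s).

(* [(t - q tau)_q^gamma] for [t > 0]. *)
Definition q_shifted_power (q t tau gamma : R) : R :=
  Rpower t gamma *
  (q_poch_inf q (q * tau / t) /
   q_poch_inf q (Rpower q (gamma + 1) * tau / t)).

Definition power_fun (beta : R) : R -> R := fun t => Rpower t (beta - 1).

(* The q-convolution of [f] with [power_fun beta]: the second factor enters
   only through its exponent. *)
Definition q_conv (q : R) (f : R -> R) (beta : R) : R -> R :=
  fun t => jackson_int q (fun tau => f tau * q_shifted_power q t tau (beta - 1)) t.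

(* Main.v *)
Require Import Defs.
From Stdlib Require Import Reals ZArith Lra Lia FunctionalExtensionality.
From Coquelicot Require Import Coquelicot.
Open Scope R_scope.

(** Write [P x] for [(x; q)_oo].  Since [E_q(-z) = P ((1 - q) z)] (Euler), the
    factor [E_q(-qst)] blows up along [t = q^n], [n -> -oo], unless
    [(1 - q) s = q^j] for some integer [j]; convergence of the transform of the
    power function therefore forces this, and then all the bilateral sums are
    one-sided, with [E_q(-qst) = P (q^(n+1))] at [t = q^(n-j)].

    With [F n = t f(t)] and [W n = P (q^(n+1)) t^beta] at [t = q^(n-j)], and
    [C k = P (q^(k+1)) / P (q^(k+beta))], the transform of the convolution is
    [sum_n W n sum_k F (n+k) C k = sum_m F m T m], where [T] is the Cauchy product
    of [W] and [C].  The recurrences of [W] and [C] yield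
    [(1 - q^(m+1)) T (m+1) = T m], which [P (q^(m+1))] also satisfies; comparing
    limits, [T m = P (q^(m+1)) sum_n W n], and the double sum factors.  The sums
    of [F] need not converge absolutely: the exchange rests on
    [C k = 1 + O(q^k)]. *)

(** * Power series of the [q]-exponential *)

Definition q_exp_coef (q : R) (n : nat) : R :=
  q ^ (n * (n - 1) / 2)%nat / q_factorial q n.

Lemma binomial_exponent_S (n : nat) :
  (S n * (S n - 1) / 2 = n * (n - 1) / 2 + n)%nat.
Proof.
replace (S n * (S n - 1))%nat with (n * (n - 1) + n * 2)%nat.
- apply Nat.div_add; lia.
- destruct n as [|n]; [reflexivity|].
  replace (S n - 1)%nat with n by lia; replace (S (S n) - 1)%nat with (S n) by lia; lia.
Qed.

Lemma Rpower_pred (t b : R) : 0 < t -> Rpower t b = t * Rpower t (b - 1).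
Proof.
intros ht; rewrite <- (Rpower_1 t) at 2 by exact ht.
rewrite <- Rpower_plus; f_equal; ring.
Qed.

Lemma pow_le_1 (q : R) (n : nat) : 0 < q < 1 -> 0 < q ^ n <= 1.
Proof.
intros hq; split; [apply pow_lt; lra|rewrite <- (pow1 n); apply pow_incr; lra].
Qed.

Lemma one_minus_pow_pos (q : R) (n : nat) : 0 < q < 1 -> 0 < 1 - q ^ S n.
Proof.
intros hq; assert (q ^ S n < 1) by (apply pow_lt_1_compat; [lra|lia]); lra.
Qed.

Lemma q_factorial_pos (q : R) (n : nat) : 0 < q < 1 -> 0 < q_factorial q n.
Proof.
intros hq; induction n as [|n IH]; simpl q_factorial; [lra|].
apply Rmult_lt_0_compat; [|exact IH].
apply Rdiv_lt_0_compat; [now apply one_minus_pow_pos|lra].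
Qed.

Lemma q_exp_coef_S (q : R) (n : nat) : 0 < q < 1 ->
  q_exp_coef q (S n) * (1 - q ^ S n) = (1 - q) * q ^ n * q_exp_coef q n.
Proof.
intros hq; unfold q_exp_coef; rewrite binomial_exponent_S, pow_add.
assert (h1 := one_minus_pow_pos q n hq); assert (h2 := q_factorial_pos q n hq).
simpl q_factorial; unfold q_number; field; repeat split; lra.
Qed.

Lemma q_exp_coef_pos (q : R) (n : nat) : 0 < q < 1 -> 0 < q_exp_coef q n.
Proof.
intros hq; apply Rdiv_lt_0_compat; [apply pow_lt; lra|now apply q_factorial_pos].
Qed.

(** The ratio of consecutive coefficients is [(1 - q) * q ^ n / (1 - q ^ S n)], at most [q ^ n]
    because [q ^ S n <= q]; it tends to 0, so the series is entire. *)
Lemma CV_radius_q_exp_coef (q : R) : 0 < q < 1 ->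
  CV_radius (q_exp_coef q) = p_infty.
Proof.
intros hq; apply CV_radius_infinite_DAlembert.
- intros n; assert (h := q_exp_coef_pos q n hq); lra.
- apply is_lim_seq_le_le with (fun _ => 0) (fun n => q ^ n).
  + intros n; split; [apply Rabs_pos|].
    assert (h0 := q_exp_coef_pos q n hq); assert (h1 := q_exp_coef_pos q (S n) hq).
    assert (h2 := one_minus_pow_pos q n hq); assert (h3 := q_exp_coef_S q n hq).
    rewrite Rabs_pos_eq by (apply Rlt_le, Rdiv_lt_0_compat; lra).
    apply Rmult_le_reg_r with (q_exp_coef q n * (1 - q ^ S n)).
    { apply Rmult_lt_0_compat; lra. }
    replace (q_exp_coef q (S n) / q_exp_coef q n * (q_exp_coef q n * (1 - q ^ S n)))
      with (q_exp_coef q (S n) * (1 - q ^ S n)) by (field; lra).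
    rewrite h3.
    replace (q ^ n * (q_exp_coef q n * (1 - q ^ S n)))
      with ((1 - q ^ S n) * q ^ n * q_exp_coef q n) by ring.
    apply Rmult_le_compat_r; [lra|]; apply Rmult_le_compat_r.
    { apply pow_le; lra. }
    assert (h4 := pow_le_1 q n hq); simpl; nra.
  + apply is_lim_seq_const.
  + apply is_lim_seq_geom; rewrite Rabs_pos_eq; lra.
Qed.

Lemma q_exp_PSeries (q z : R) : q_exp q z = PSeries (q_exp_coef q) z.
Proof.
apply Series_ext; intros n; unfold q_exp_coef, Rdiv; ring.
Qed.

Lemma ex_pseries_q_exp (q z : R) : 0 < q < 1 -> ex_pseries (q_exp_coef q) z.
Proof.
intros hq; apply CV_radius_inside; now rewrite CV_radius_q_exp_coef.
Qed.

Lemma ex_series_q_exp (q z : R) : 0 < q < 1 ->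
  ex_series (fun n => q_exp_coef q n * z ^ n).
Proof.
intros hq; apply ex_pseries_R; now apply ex_pseries_q_exp.
Qed.

(* The [q]-difference equation [D_q E_q(z) = E_q(qz)], cleared of denominators. *)
Lemma q_exp_step (q z : R) : 0 < q < 1 ->
  q_exp q z = (1 + (1 - q) * z) * q_exp q (q * z).
Proof.
intros hq; rewrite !q_exp_PSeries; unfold PSeries.
rewrite (Series_incr_1 _ (ex_series_q_exp q z hq)).
assert (hz := ex_series_q_exp q (q * z) hq).
rewrite Rmult_plus_distr_r, Rmult_1_l, <- Series_scal_l.
rewrite (Series_incr_1 _ hz), Rplus_assoc, <- Series_plus.
- apply (f_equal2 Rplus); [simpl; ring|]; apply Series_ext; intros n.
  (* Splitting 1 as [q ^ S n + (1 - q ^ S n)] separates the coefficient of [q_exp q (q * z)] from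
     the part that [q_exp_coef_S] lowers to degree [n]. *)
  replace (q_exp_coef q (S n) * z ^ S n)
    with (q_exp_coef q (S n) * q ^ S n * z ^ S n
          + q_exp_coef q (S n) * (1 - q ^ S n) * z ^ S n) by ring.
  rewrite q_exp_coef_S, !Rpow_mult_distr by exact hq; simpl; ring.
- exact (proj1 (ex_series_incr_1 (V := R_NormedModule) _) hz).
- exact (ex_series_scal (V := R_NormedModule) ((1 - q) * z) _ hz).
Qed.

Lemma q_exp_0 (q : R) : q_exp q 0 = 1.
Proof.
rewrite q_exp_PSeries, PSeries_0; unfold q_exp_coef; simpl; field.
Qed.

Lemma continuity_pt_q_exp (q z : R) : 0 < q < 1 -> continuity_pt (q_exp q) z.
Proof.
intros hq; apply continuity_pt_ext with (PSeries (q_exp_coef q)).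
- intros x; symmetry; apply q_exp_PSeries.
- apply PSeries_continuity; now rewrite CV_radius_q_exp_coef.
Qed.

(** * Euler's identity between the [q]-exponential and the infinite product *)

Lemma q_exp_prod (q x : R) (n : nat) : 0 < q < 1 ->
  q_exp q (- (x / (1 - q)))
  = prod_f_R0 (fun i => 1 - x * q ^ i) n * q_exp q (- (x * q ^ S n / (1 - q))).
Proof.
intros hq.
(* At [z = - y / (1 - q)] the factor [1 + (1 - q) * z] becomes [1 - y]. It is applied [S n] times,
   since [prod_f_R0] up to [n] includes the index [n]. *)
assert (step : forall y, q_exp q (- (y / (1 - q)))
  = (1 - y) * q_exp q (- (y * q / (1 - q)))).
{ intros y; rewrite q_exp_step by exact hq; f_equal; [field; lra|f_equal; field; lra]. }
induction n as [|n IH]; simpl prod_f_R0.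
- rewrite step; simpl; rewrite !Rmult_1_r; reflexivity.
- rewrite IH, step.
  replace (x * q ^ S n * q) with (x * q ^ S (S n)) by (simpl; ring); simpl; ring.
Qed.

Lemma is_lim_seq_geom_scal (q x : R) : 0 < q < 1 ->
  is_lim_seq (fun n => x * q ^ n) 0.
Proof.
intros hq; rewrite <- (Rmult_0_r x).
apply (is_lim_seq_scal_l _ x 0), is_lim_seq_geom; rewrite Rabs_pos_eq; lra.
Qed.

(** The partial products are the quotients of the fixed value [E] by a remainder that tends to
    [q_exp q 0 = 1]. *)
Lemma q_poch_inf_q_exp (q x : R) : 0 < q < 1 ->
  q_poch_inf q x = q_exp q (- (x / (1 - q))).
Proof.
intros hq; unfold q_poch_inf.
assert (hlim : is_lim_seq (fun n => q_exp q (- (x * q ^ S n / (1 - q)))) 1).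
{ replace (Finite 1) with (Finite (q_exp q 0)) by (f_equal; apply q_exp_0).
  apply is_lim_seq_continuous; [now apply continuity_pt_q_exp|].
  apply (is_lim_seq_incr_1 (fun n => - (x * q ^ n / (1 - q)))).
  apply is_lim_seq_ext with (fun n => (- x / (1 - q)) * q ^ n).
  { intros n; field; lra. }
  now apply is_lim_seq_geom_scal. }
set (E := q_exp q (- (x / (1 - q)))).
assert (h : is_lim_seq (fun n => E / q_exp q (- (x * q ^ S n / (1 - q)))) E).
{ replace (Finite E) with (Finite (E / 1)) by (f_equal; field).
  apply is_lim_seq_div'; [apply is_lim_seq_const|exact hlim|lra]. }
(* The remainder may vanish for small [n], so partial products and quotients are identified only
   from some rank on. *)
assert (hne : eventually (fun n => q_exp q (- (x * q ^ S n / (1 - q))) <> 0)).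
{ apply is_lim_seq_spec in hlim; destruct (hlim (mkposreal (1/2) ltac:(lra))) as [N hN].
  exists N; intros n hn e; specialize (hN n hn); simpl in hN.
  simpl pow in e; rewrite e in hN; apply Rabs_def2 in hN; lra. }
rewrite (is_lim_seq_unique _ (Finite E)); [reflexivity|].
apply is_lim_seq_ext_loc with (2 := h).
destruct hne as [N hN]; exists N; intros n hn.
unfold E; rewrite (q_exp_prod q x n hq); field; now apply hN.
Qed.

Lemma q_poch_inf_0 (q : R) : 0 < q < 1 -> q_poch_inf q 0 = 1.
Proof.
intros hq; rewrite q_poch_inf_q_exp by exact hq.
replace (- (0 / (1 - q))) with 0 by (field; lra); apply q_exp_0.
Qed.

Lemma q_poch_inf_prod (q x : R) (n : nat) : 0 < q < 1 ->
  q_poch_inf q x = prod_f_R0 (fun i => 1 - x * q ^ i) n * q_poch_inf q (x * q ^ S n).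
Proof.
intros hq; rewrite !q_poch_inf_q_exp by exact hq; now apply q_exp_prod.
Qed.

Lemma q_poch_inf_step (q x : R) : 0 < q < 1 ->
  q_poch_inf q x = (1 - x) * q_poch_inf q (x * q).
Proof.
intros hq; rewrite (q_poch_inf_prod q x 0 hq); simpl; now rewrite !Rmult_1_r.
Qed.

(** * Geometric rate of convergence and zeros of the infinite product *)

Lemma is_lim_seq_bounded (u : nat -> R) (l : R) : is_lim_seq u l ->
  exists M, 0 <= M /\ forall n, Rabs (u n) <= M.
Proof.
intros h; destruct (filterlim_bounded (V := R_NormedModule) u) as [M hM].
- exists l; exact h.
- exists M; split; [|exact hM].
  apply Rle_trans with (2 := hM 0%nat); apply Rabs_pos.
Qed.

(** Dividing out the variable gives [q_exp q z = 1 + z * PSeries d z] with [PSeries d] continuous,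
    hence bounded along the null sequence [u]; the factor [u k] supplies the rate [q ^ k]. *)
Lemma q_poch_inf_geom_error (q c : R) : 0 < q < 1 ->
  exists K, 0 <= K /\ forall k : nat, Rabs (q_poch_inf q (c * q ^ k) - 1) <= K * q ^ k.
Proof.
intros hq; set (d := PS_decr_1 (q_exp_coef q)).
set (u := fun k : nat => (- c / (1 - q)) * q ^ k).
assert (hu : is_lim_seq (fun k => PSeries d (u k)) (PSeries d 0)).
{ apply is_lim_seq_continuous; [|now apply is_lim_seq_geom_scal].
  apply PSeries_continuity; unfold d; rewrite CV_radius_decr_1.
  now rewrite CV_radius_q_exp_coef. }
destruct (is_lim_seq_bounded _ _ hu) as [M [hM0 hM]].
exists (Rabs (- c / (1 - q)) * M); split.
{ apply Rmult_le_pos; [apply Rabs_pos|exact hM0]. }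
intros k; rewrite q_poch_inf_q_exp by exact hq.
replace (- (c * q ^ k / (1 - q))) with (u k) by (unfold u; field; lra).
rewrite q_exp_PSeries, PSeries_decr_1 by now apply ex_pseries_q_exp.
replace (q_exp_coef q 0 + u k * PSeries (PS_decr_1 (q_exp_coef q)) (u k) - 1)
  with ((- c / (1 - q)) * PSeries d (u k) * q ^ k)
  by (unfold u, d, q_exp_coef at 2; simpl; field; lra).
rewrite !Rabs_mult, (Rabs_pos_eq (q ^ k)) by (apply pow_le; lra).
apply Rmult_le_compat_r; [apply pow_le; lra|].
apply Rmult_le_compat_l; [apply Rabs_pos|apply hM].
Qed.

Lemma is_lim_seq_geom_error (q l K : R) (u : nat -> R) : 0 < q < 1 ->
  (forall k, Rabs (u k - l) <= K * q ^ k) -> is_lim_seq u l.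
Proof.
intros hq h; apply is_lim_seq_ext with (fun k => (u k - l) + l).
{ intros; ring. }
replace (Finite l) with (Finite (0 + l)) by (f_equal; ring).
apply is_lim_seq_plus'; [|apply is_lim_seq_const].
apply is_lim_seq_abs_0, is_lim_seq_le_le with (fun _ => 0) (fun k => K * q ^ k).
- intros n; split; [apply Rabs_pos|apply h].
- apply is_lim_seq_const.
- now apply is_lim_seq_geom_scal.
Qed.

Lemma is_lim_seq_q_poch_inf (q c : R) : 0 < q < 1 ->
  is_lim_seq (fun k => q_poch_inf q (c * q ^ k)) 1.
Proof.
intros hq; destruct (q_poch_inf_geom_error q c hq) as [K [_ hK]].
now apply is_lim_seq_geom_error with q K.
Qed.

(** For large [N] the value at [x * q ^ N] is within 1/2 of 1, hence nonzero. Going back one factor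
    at a time, nonvanishing persists down to [x] unless some factor [1 - x * q ^ i] is zero. *)
Lemma q_poch_inf_root (q x : R) : 0 < q < 1 ->
  q_poch_inf q x = 0 -> exists i : nat, x * q ^ i = 1.
Proof.
intros hq h0.
destruct (proj2 (is_lim_seq_spec _ _) (is_lim_seq_q_poch_inf q x hq)
  (mkposreal (1/2) ltac:(lra))) as [N hN].
specialize (hN N (le_n N)); simpl in hN.
assert (hne : q_poch_inf q (x * q ^ N) <> 0).
{ intros e; rewrite e in hN; apply Rabs_def2 in hN; lra. }
clear hN; induction N as [|N IH].
- exfalso; apply hne; simpl; now rewrite Rmult_1_r.
- destruct (Req_dec (1 - x * q ^ N) 0) as [e|e]; [exists N; lra|].
  apply IH; rewrite q_poch_inf_step by exact hq.
  replace (x * q ^ N * q) with (x * q ^ S N) by (simpl; ring).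
  now apply Rmult_integral_contrapositive.
Qed.

Lemma q_poch_inf_neq_0 (q x : R) : 0 < q < 1 -> x < 1 -> q_poch_inf q x <> 0.
Proof.
intros hq hx h; destruct (q_poch_inf_root q x hq h) as [i hi].
assert (h1 := pow_le_1 q i hq); nra.
Qed.

(** The numerator and the denominator are both [1 + O(q ^ k)], and the inverse denominators are
    bounded because they converge; [c < 1] keeps every denominator away from the zeros. *)
Lemma q_poch_inf_ratio_geom_error (q c d : R) : 0 < q < 1 -> c < 1 ->
  exists K, 0 <= K /\
    forall k : nat, Rabs (q_poch_inf q (d * q ^ k) / q_poch_inf q (c * q ^ k) - 1) <= K * q ^ k.
Proof.
intros hq hc.
destruct (q_poch_inf_geom_error q c hq) as [Kc [hKc0 hKc]].
destruct (q_poch_inf_geom_error q d hq) as [Kd [hKd0 hKd]].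
assert (hne : forall k : nat, q_poch_inf q (c * q ^ k) <> 0).
{ intros k; apply q_poch_inf_neq_0; [exact hq|].
  assert (h := pow_le_1 q k hq); nra. }
assert (hinv : is_lim_seq (fun k => / q_poch_inf q (c * q ^ k)) (/ 1)).
{ apply (is_lim_seq_inv _ 1); [now apply is_lim_seq_q_poch_inf|intros e; injection e; lra]. }
destruct (is_lim_seq_bounded _ _ hinv) as [B [hB0 hB]].
exists ((Kd + Kc) * B); split; [apply Rmult_le_pos; lra|]; intros k.
set (pc := q_poch_inf q (c * q ^ k)) in *; set (pd := q_poch_inf q (d * q ^ k)) in *.
replace (pd / pc - 1) with (((pd - 1) - (pc - 1)) * / pc) by (field; apply hne).
rewrite Rabs_mult.
replace ((Kd + Kc) * B * q ^ k) with ((Kd * q ^ k + Kc * q ^ k) * B) by ring.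
apply Rmult_le_compat; [apply Rabs_pos|apply Rabs_pos| |apply hB].
apply Rle_trans with (1 := Rabs_triang _ _); rewrite Rabs_Ropp.
apply Rplus_le_compat; [apply hKd|apply hKc].
Qed.

(** * Cauchy products: recurrence and finite interchange *)

Definition cauchy_coef (u v : nat -> R) (m : nat) : R :=
  sum_f_R0 (fun n => u n * v (m - n)%nat) m.

(* Splits [1 - q^(m+1) = (1 - q^(m+1-n)) + q^(m+1-n) (1 - q^n)] in each term. *)
Lemma cauchy_coef_step (q x : R) (W C : nat -> R) (m : nat) :
  (forall n, (1 - q ^ S n) * W (S n) = x * W n) ->
  (forall k, (1 - q ^ S k) * C (S k) = (1 - x * q ^ k) * C k) ->
  (1 - q ^ S m) * cauchy_coef W C (S m) = cauchy_coef W C m.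
Proof.
intros hW hC; unfold cauchy_coef; rewrite scal_sum.
rewrite (sum_eq _ (fun n => W n * ((1 - q ^ (S m - n)) * C (S m - n)%nat)
    + q ^ (S m - n) * C (S m - n)%nat * ((1 - q ^ n) * W n))).
2:{ intros n hn; replace (q ^ S m) with (q ^ (S m - n) * q ^ n); [ring|].
    rewrite <- pow_add; f_equal; lia. }
(* The last term of the first sum and the first term of the second carry the factor [1 - q ^ 0 = 0].
   Both remaining sums run to [m], and their terms in [x] cancel. *)
rewrite sum_plus, tech5, Nat.sub_diag, (decomp_sum _ (S m)) by lia.
simpl pred; simpl (q ^ 0).
rewrite (sum_eq _ (fun n => W n * C (m - n)%nat
    - x * q ^ (m - n) * W n * C (m - n)%nat) m).
2:{ intros n hn; replace (S m - n)%nat with (S (m - n)) by lia; rewrite hC; ring. }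
rewrite (sum_eq (fun i => q ^ (S m - S i) * _ * _)
    (fun n => x * q ^ (m - n) * W n * C (m - n)%nat) m).
2:{ intros n hn; simpl (S m - S n)%nat; rewrite hW; ring. }
rewrite <- !(sum_eq (fun n => (W n * C (m - n)%nat - x * q ^ (m - n) * W n * C (m - n)%nat)
    + x * q ^ (m - n) * W n * C (m - n)%nat) (fun n => W n * C (m - n)%nat) m)
  by (intros; ring).
rewrite (sum_plus (fun n => W n * C (m - n)%nat - x * q ^ (m - n) * W n * C (m - n)%nat)).
ring.
Qed.

(** Both sides sum over the triangle [n + k <= M], by antidiagonals and by rows. Passing to [S M]
    appends the entry [k = S M - n] to each row. *)
Lemma sum_cauchy_coef_exchange (F W C : nat -> R) (M : nat) :
  sum_f_R0 (fun m => F m * cauchy_coef W C m) M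
  = sum_f_R0 (fun n => W n * sum_f_R0 (fun k => F (n + k)%nat * C k) (M - n)) M.
Proof.
induction M as [|M IH]; [unfold cauchy_coef; simpl; ring|].
rewrite tech5, IH; unfold cauchy_coef; rewrite !(tech5 _ M), Nat.sub_diag.
rewrite (sum_eq (fun n => W n * sum_f_R0 _ (S M - n))
  (fun n => W n * sum_f_R0 (fun k => F (n + k)%nat * C k) (M - n)
            + (W n * C (S M - n)%nat) * F (S M)) M).
- rewrite sum_plus, <- scal_sum; simpl sum_f_R0; rewrite Nat.add_0_r; ring.
- intros n hn; replace (S M - n)%nat with (S (M - n)) by lia; rewrite tech5.
  replace (n + S (M - n))%nat with (S M) by lia; ring.
Qed.

Lemma is_lim_seq_Series_tail (F : nat -> R) : ex_series F ->
  is_lim_seq (fun M => Series (fun k => F (M + k)%nat)) 0.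
Proof.
intros hF; apply is_lim_seq_incr_1.
apply is_lim_seq_ext with (fun M => Series F - sum_n F M).
{ intros M; rewrite (Series_incr_n F (S M)), sum_n_Reals by (lia || exact hF).
  simpl pred; ring. }
replace (Finite 0) with (Finite (Series F - Series F)) by (f_equal; ring).
apply is_lim_seq_minus'; [apply is_lim_seq_const|].
now apply Series_correct in hF.
Qed.

(** * Interchange and limits for weights geometrically close to 1 *)

Section GeometricWeights.
Variables (q K : R) (F C : nat -> R).
Hypotheses (hq : 0 < q < 1) (hK : 0 <= K) (hF : ex_series F).
Hypothesis hC : forall k, Rabs (C k - 1) <= K * q ^ k.

(** Mere boundedness of [F] suffices against [C - 1], by comparison with a geometric series. The
    bound is uniform in the shift [p] since [q ^ (p + k) <= q ^ k]. *)
Lemma weighted_tail_remainder (M p : nat) (eta : R) :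
  (forall k, Rabs (F (M + k)%nat) <= eta) ->
  ex_series (fun k => Rabs (F (M + k)%nat * (C (p + k)%nat - 1))) /\
  Rabs (Series (fun k => F (M + k)%nat * (C (p + k)%nat - 1))) <= eta * K / (1 - q).
Proof.
intros heta.
assert (hle : forall k, 0 <= Rabs (F (M + k)%nat * (C (p + k)%nat - 1)) <= eta * K * q ^ k).
{ intros k; split; [apply Rabs_pos|]; rewrite Rabs_mult, Rmult_assoc.
  apply Rmult_le_compat; [apply Rabs_pos|apply Rabs_pos|apply heta|].
  apply Rle_trans with (1 := hC _); apply Rmult_le_compat_l; [exact hK|].
  rewrite pow_add; rewrite <- (Rmult_1_l (q ^ k)) at 2.
  apply Rmult_le_compat_r; [apply pow_le; lra|].
  rewrite <- (pow1 p); apply pow_incr; lra. }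
assert (hg : is_series (fun k => eta * K * q ^ k) (eta * K / (1 - q))).
{ apply (is_series_scal (V := R_NormedModule) (eta * K)), is_series_geom.
  rewrite Rabs_pos_eq; lra. }
assert (hex : ex_series (fun k => Rabs (F (M + k)%nat * (C (p + k)%nat - 1)))).
{ apply (ex_series_le (V := R_CompleteNormedModule) _ (fun k => eta * K * q ^ k)).
  - intros k; change norm with Rabs; rewrite Rabs_Rabsolu; apply hle.
  - now exists (eta * K / (1 - q)). }
split; [exact hex|].
apply Rle_trans with (1 := Series_Rabs _ hex).
rewrite <- (is_series_unique _ _ hg); apply Series_le; [exact hle|].
now exists (eta * K / (1 - q)).
Qed.

Lemma ex_series_shift (M : nat) : ex_series (fun k => F (M + k)%nat).
Proof. exact (proj1 (ex_series_incr_n (V := R_NormedModule) F M) hF). Qed.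

Lemma ex_series_weighted (M p : nat) :
  ex_series (fun k => F (M + k)%nat * C (p + k)%nat).
Proof.
destruct (is_lim_seq_bounded _ _ (ex_series_lim_0 _ (ex_series_shift M))) as [B [_ hB]].
destruct (weighted_tail_remainder M p B hB) as [h _].
apply ex_series_ext with (fun k => F (M + k)%nat + F (M + k)%nat * (C (p + k)%nat - 1)).
{ intros; simpl; ring. }
apply (ex_series_plus (V := R_NormedModule)); [apply ex_series_shift|now apply ex_series_Rabs].
Qed.

(** Write [C = 1 + (C - 1)]: the first part is a tail of the convergent series of [F], the second is
    controlled by the largest term of that tail. Uniformity in [p] matters because the interchange
    meets a different shift in each row. *)
Lemma weighted_tail_uniform (eps : R) : 0 < eps ->
  exists N, forall M p, (N <= M)%nat ->
    Rabs (Series (fun k => F (M + k)%nat * C (p + k)%nat)) <= eps.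
Proof.
intros heps; assert (hA : 0 < 1 + K / (1 - q)).
{ assert (0 <= K / (1 - q)) by (apply Rdiv_le_0_compat; lra); lra. }
(* With [eta = eps / A], the two parts are at most [eta] and [eta * K / (1 - q)], which add up to
   [eps]. *)
remember (1 + K / (1 - q)) as A eqn:hAdef.
assert (heta : 0 < eps / A) by now apply Rdiv_lt_0_compat.
destruct (proj2 (is_lim_seq_spec _ _) (ex_series_lim_0 _ hF) (mkposreal _ heta)) as [N1 h1].
destruct (proj2 (is_lim_seq_spec _ _) (is_lim_seq_Series_tail _ hF) (mkposreal _ heta))
  as [N2 h2].
simpl in h1, h2; exists (max N1 N2); intros M p hM.
assert (hb : forall k, Rabs (F (M + k)%nat) <= eps / A).
{ intros k; specialize (h1 (M + k)%nat ltac:(lia)); rewrite Rminus_0_r in h1; lra. }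
destruct (weighted_tail_remainder M p _ hb) as [hex hle].
rewrite (Series_ext _ (fun k => F (M + k)%nat + F (M + k)%nat * (C (p + k)%nat - 1)))
  by (intros; ring).
rewrite Series_plus by (apply ex_series_shift || now apply ex_series_Rabs).
apply Rle_trans with (1 := Rabs_triang _ _).
specialize (h2 M ltac:(lia)); rewrite Rminus_0_r in h2.
assert (e : eps / A * A = eps) by (field; lra).
rewrite hAdef in e at 2; rewrite Rmult_plus_distr_l, Rmult_1_r in e.
unfold Rdiv in *; rewrite <- Rmult_assoc in e.
lra.
Qed.

(** The partial sum of the iterated series exceeds the triangular sum by the row tails weighted by
    [W]; a uniform bound on the tails times the sum of [Rabs (W n)] sends this excess to 0. *)
Lemma is_series_cauchy_coef_exchange (W : nat -> R) (L : R) :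
  ex_series (fun n => Rabs (W n)) ->
  is_series (fun m => F m * cauchy_coef W C m) L ->
  is_series (fun n => W n * Series (fun k => F (n + k)%nat * C k)) L.
Proof.
intros hW hL; change (is_lim_seq (sum_n (fun n => W n * Series (fun k => F (n + k)%nat * C k))) L).
change (is_lim_seq (sum_n (fun m => F m * cauchy_coef W C m)) L) in hL.
(* Row [n] of the triangle stops at [k = M - n], so its tail starts at index [S M] for [F] and
   [S (M - n)] for [C]. *)
set (tail := fun M n => Series (fun k => F (S M + k)%nat * C (S (M - n) + k)%nat)).
apply is_lim_seq_ext with
  (fun M => sum_n (fun m => F m * cauchy_coef W C m) M + sum_f_R0 (fun n => W n * tail M n) M).
{ intros M; rewrite !sum_n_Reals, sum_cauchy_coef_exchange, <- sum_plus.
  apply sum_eq; intros n hn; rewrite <- Rmult_plus_distr_l; f_equal.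
  rewrite (Series_incr_n (fun k => F (n + k)%nat * C k) (S (M - n)));
    [|lia|exact (ex_series_weighted n 0)].
  simpl pred; f_equal; apply Series_ext; intros k; f_equal; f_equal; lia. }
replace (Finite L) with (Finite (L + 0)) by (f_equal; ring).
apply is_lim_seq_plus'; [exact hL|].
set (V := Series (fun n => Rabs (W n))).
assert (hV : forall M, sum_f_R0 (fun n => Rabs (W n)) M <= V).
{ intros M; unfold V; rewrite (Series_incr_n _ (S M)) by (lia || exact hW); simpl pred.
  assert (0 <= Series (fun k => Rabs (W (S M + k)%nat))); [|lra].
  rewrite <- (Rmult_0_l (Series (fun k => Rabs (W (S M + k)%nat)))), <- Series_scal_l.
  apply Series_le.
  - intros n; rewrite Rmult_0_l; split; [lra|apply Rabs_pos].
  - exact (proj1 (ex_series_incr_n (V := R_NormedModule) _ (S M)) hW). }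
assert (hV0 : 0 <= V) by (apply Rle_trans with (2 := hV 0%nat); apply Rabs_pos).
apply is_lim_seq_spec; intros eps.
(* Dividing by [V + 1] covers [V = 0] and makes the final inequality strict. *)
assert (he : 0 < eps / (V + 1)) by (apply Rdiv_lt_0_compat; [apply cond_pos|lra]).
destruct (weighted_tail_uniform _ he) as [N hN]; exists N; intros M hM.
rewrite Rminus_0_r.
apply Rle_lt_trans with (1 := Rsum_abs _ _).
apply Rle_lt_trans with (eps / (V + 1) * V).
- apply Rle_trans with (sum_f_R0 (fun n => Rabs (W n) * (eps / (V + 1))) M).
  + apply sum_Rle; intros n hn; rewrite Rabs_mult.
    apply Rmult_le_compat_l; [apply Rabs_pos|apply hN; lia].
  + rewrite <- scal_sum; apply Rmult_le_compat_l; [lra|apply hV].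
- assert (h := cond_pos eps); replace (pos eps) with (eps / (V + 1) * (V + 1)) at 2 by (field; lra).
  apply Rmult_lt_compat_l; lra.
Qed.

(** With [D = C - 1], the coefficient is a partial sum of [W] plus a coefficient of the product of
    two absolutely convergent series, which tends to 0 as the general term of a convergent
    series. *)
Lemma is_lim_seq_cauchy_coef (W : nat -> R) :
  ex_series (fun n => Rabs (W n)) -> is_lim_seq (cauchy_coef W C) (Series W).
Proof.
intros hW; assert (hW1 := ex_series_Rabs _ hW).
set (D := fun k => C k - 1).
assert (hD : ex_series (fun k => Rabs (D k))).
{ apply (ex_series_le (V := R_CompleteNormedModule) _ (fun k => K * q ^ k)).
  - intros k; change norm with Rabs; rewrite Rabs_Rabsolu; apply hC.
  - apply (ex_series_scal (V := R_NormedModule) K).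
    exists (/ (1 - q)); apply is_series_geom; rewrite Rabs_pos_eq; lra. }
assert (h := is_series_mult _ _ _ _ (Series_correct _ hW1)
  (Series_correct _ (ex_series_Rabs _ hD)) hW hD).
assert (h0 := ex_series_lim_0 _ (ex_intro _ _ h)).
apply is_lim_seq_ext with (fun m => sum_n W m + sum_f_R0 (fun k => W k * D (m - k)%nat) m).
{ intros m; rewrite sum_n_Reals, <- sum_plus; apply sum_eq; intros; unfold D; ring. }
replace (Finite (Series W)) with (Finite (Series W + 0)) by (f_equal; ring).
apply is_lim_seq_plus'; [|exact h0].
exact (Series_correct _ hW1).
Qed.

End GeometricWeights.

(** * Bilateral series: shifts and one-sided support *)

Definition is_bilateral_series (h : Z -> R) (l : R) : Prop :=
  exists l1 l2, is_series (fun n : nat => h (Z.of_nat n)) l1 /\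
    is_series (fun n : nat => h (- Z.of_nat (S n))%Z) l2 /\ l = l1 + l2.

Lemma bilateral_series_correct (h : Z -> R) :
  ex_bilateral_series h -> is_bilateral_series h (bilateral_series h).
Proof.
intros [h1 h2]; do 2 eexists; repeat split; now apply Series_correct.
Qed.

Lemma is_bilateral_series_unique (h : Z -> R) (l : R) :
  is_bilateral_series h l -> bilateral_series h = l.
Proof.
intros [l1 [l2 [h1 [h2 ->]]]]; unfold bilateral_series.
now rewrite (is_series_unique _ _ h1), (is_series_unique _ _ h2).
Qed.

Lemma is_series_behead (u : nat -> R) (l : R) :
  is_series u l -> is_series (fun n => u (S n)) (l - u 0%nat).
Proof.
intros h; apply (is_series_incr_1 (V := R_NormedModule)).
change (is_series u (l - u 0%nat + u 0%nat)).
now replace (l - u 0%nat + u 0%nat) with l by ring.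
Qed.

Lemma is_series_cons (u : nat -> R) (l : R) :
  is_series (fun n => u (S n)) l -> is_series u (l + u 0%nat).
Proof.
intros h; apply (is_series_decr_1 (V := R_NormedModule)).
change (is_series (fun n => u (S n)) (l + u 0%nat + - u 0%nat)).
now replace (l + u 0%nat + - u 0%nat) with l by ring.
Qed.

(** The shift moves the single term [h 0] from the nonnegative half to the negative one. *)
Lemma is_bilateral_series_succ (h : Z -> R) (l : R) :
  is_bilateral_series h l <-> is_bilateral_series (fun n => h (Z.succ n)) l.
Proof.
split; intros [l1 [l2 [h1 [h2 ->]]]].
- exists (l1 - h 0%Z), (l2 + h 0%Z); split; [|split; [|ring]].
  + apply is_series_ext with (2 := is_series_behead _ _ h1); intros n; f_equal; lia.
  + apply (is_series_cons (fun n => h (Z.succ (- Z.of_nat (S n))))).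
    apply is_series_ext with (2 := h2); intros n; f_equal; lia.
- exists (l1 + h 0%Z), (l2 - h 0%Z); split; [|split; [|ring]].
  + apply (is_series_cons (fun n => h (Z.of_nat n))).
    apply is_series_ext with (2 := h1); intros n; f_equal; lia.
  + apply is_series_ext with (2 := is_series_behead _ _ h2); intros n; f_equal; lia.
Qed.

Lemma is_bilateral_series_shift (h : Z -> R) (l : R) (p : Z) :
  is_bilateral_series h l <-> is_bilateral_series (fun n => h (n + p)%Z) l.
Proof.
revert p; apply Z.bi_induction.
- intros p p' e; change (p = p') in e; now subst.
- replace (fun n => h (n + 0)%Z) with h; [reflexivity|].
  apply functional_extensionality; intros n; f_equal; lia.
- intros p; rewrite (is_bilateral_series_succ (fun n => h (n + p)%Z)).
  replace (fun n => h (n + Z.succ p)%Z) with (fun n => h (Z.succ n + p)%Z); [reflexivity|].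
  apply functional_extensionality; intros n; f_equal; lia.
Qed.

Lemma is_bilateral_series_half (h : Z -> R) (l : R) :
  (forall n, (n < 0)%Z -> h n = 0) ->
  is_bilateral_series h l <-> is_series (fun n : nat => h (Z.of_nat n)) l.
Proof.
intros h0.
assert (hz : is_series (fun n : nat => h (- Z.of_nat (S n))%Z) 0).
{ change (is_lim_seq (sum_n (fun n : nat => h (- Z.of_nat (S n))%Z)) 0).
  apply is_lim_seq_ext with (fun _ => 0); [|apply is_lim_seq_const].
  intros n; rewrite sum_n_Reals; symmetry; apply sum_eq_R0; intros; apply h0; lia. }
split.
- intros [l1 [l2 [h1 [h2 ->]]]].
  rewrite <- (is_series_unique _ _ h2), (is_series_unique _ _ hz), Rplus_0_r; exact h1.
- intros h1; exists l, 0; repeat split; [exact h1|exact hz|ring].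
Qed.

Lemma is_bilateral_series_from (h : Z -> R) (l : R) (p : Z) :
  (forall n, (n < p)%Z -> h n = 0) ->
  is_bilateral_series h l <-> is_series (fun n : nat => h (Z.of_nat n + p)%Z) l.
Proof.
intros h0; rewrite (is_bilateral_series_shift h l p).
apply (is_bilateral_series_half (fun n => h (n + p)%Z)).
intros n hn; apply h0; lia.
Qed.

(** * The lattice of powers of [q] and one-sided transforms *)

(* Otherwise [|(sigma q^(-n); q)_oo|] is eventually nondecreasing and positive. *)
Lemma q_poch_inf_null_limit (q sigma : R) : 0 < q < 1 -> 0 < sigma ->
  is_lim_seq (fun n => q_poch_inf q (sigma * / q ^ n)) 0 ->
  exists n i : nat, sigma * / q ^ n * q ^ i = 1.
Proof.
intros hq hs hlim; set (b := fun n => Rabs (q_poch_inf q (sigma * / q ^ n))).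
assert (hqn : forall n, 0 < q ^ n) by (intros n; apply pow_lt; lra).
(* Once [q ^ n < sigma / 2], the point [sigma * / q ^ n] is at least 2, and the new factor
   [1 - sigma * / q ^ n] has absolute value at least 1. *)
destruct (proj2 (is_lim_seq_spec _ _) (is_lim_seq_geom q ltac:(rewrite Rabs_pos_eq; lra))
  (mkposreal (sigma / 2) ltac:(lra))) as [N hN]; simpl in hN.
assert (hmono : forall k, b N <= b (N + k)%nat).
{ induction k as [|k IH]; [rewrite Nat.add_0_r; lra|].
  apply Rle_trans with (1 := IH).
  replace (N + S k)%nat with (S (N + k)) by lia; unfold b.
  assert (hk := hN (S (N + k)) ltac:(lia)); assert (hp := hqn (S (N + k))).
  rewrite Rminus_0_r, Rabs_pos_eq in hk by lra.
  rewrite (q_poch_inf_step q (sigma * / q ^ S (N + k)) hq), Rabs_mult.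
  replace (sigma * / q ^ S (N + k) * q) with (sigma * / q ^ (N + k))
    by (simpl; assert (h := hqn (N + k)%nat); field; lra).
  rewrite <- (Rmult_1_l (Rabs (q_poch_inf q (sigma * / q ^ (N + k))))) at 1.
  apply Rmult_le_compat_r; [apply Rabs_pos|].
  assert (2 <= sigma * / q ^ S (N + k)).
  { apply Rmult_le_reg_r with (1 := hp); rewrite Rmult_assoc, Rinv_l; lra. }
  rewrite Rabs_minus_sym, Rabs_pos_eq; lra. }
assert (hb0 : b N = 0).
{ apply Rle_antisym; [|apply Rabs_pos].
  apply (is_lim_seq_le (fun _ => b N) (fun k => b (k + N)%nat) (b N) 0).
  - intros k; rewrite Nat.add_comm; apply hmono.
  - apply is_lim_seq_const.
  - apply (is_lim_seq_incr_n b N); exact (proj1 (is_lim_seq_abs_0 _) hlim). }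
apply Rabs_eq_0 in hb0; destruct (q_poch_inf_root _ _ hq hb0) as [i hi].
now exists N, i.
Qed.

Lemma powerRZ_of_nat_add (q : R) (n : nat) (p : Z) : 0 < q ->
  powerRZ q (Z.of_nat n + p) = q ^ n * powerRZ q p.
Proof. intros hq; rewrite powerRZ_add by lra; now rewrite <- pow_powerRZ. Qed.

Lemma q_exp_powerRZ (q s : R) (j m : Z) : 0 < q < 1 -> (1 - q) * s = powerRZ q j ->
  q_exp q (- (q * s * powerRZ q m)) = q_poch_inf q (powerRZ q (m + j + 1)).
Proof.
intros hq hs; rewrite q_poch_inf_q_exp by exact hq; f_equal.
rewrite !powerRZ_add, <- hs by lra; simpl; field; lra.
Qed.

(** The product contains the factor [1 - q ^ 0]. This is what kills one end of the bilateral
    sums. *)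
Lemma q_poch_inf_powerRZ_nonpos (q : R) (m : Z) : 0 < q < 1 -> (m <= 0)%Z ->
  q_poch_inf q (powerRZ q m) = 0.
Proof.
intros hq hm.
assert (h : forall n : nat, q_poch_inf q (powerRZ q (- Z.of_nat n)) = 0).
{ induction n as [|n IH].
  - rewrite q_poch_inf_step by exact hq; simpl; ring.
  - rewrite q_poch_inf_step by exact hq.
    replace (powerRZ q (- Z.of_nat (S n)) * q) with (powerRZ q (- Z.of_nat n)).
    + rewrite IH; ring.
    + rewrite <- (powerRZ_1 q) at 3; rewrite <- powerRZ_add by lra; f_equal; lia. }
replace m with (- Z.of_nat (Z.to_nat (- m)))%Z by lia; apply h.
Qed.

Lemma Rpower_pow_base (q b : R) (n : nat) : 0 < q -> Rpower (q ^ n) b = Rpower q b ^ n.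
Proof.
intros hq; rewrite <- !Rpower_pow by (exact hq || apply exp_pos).
rewrite !Rpower_mult; f_equal; ring.
Qed.

Lemma Rpower_lt_1 (q b : R) : 0 < q < 1 -> 0 < b -> 0 < Rpower q b < 1.
Proof.
intros hq hb; split; [apply exp_pos|].
rewrite <- exp_0; apply exp_increasing.
assert (h : ln q < ln 1) by (apply ln_increasing; lra); rewrite ln_1 in h; nra.
Qed.

(** Convergence at large [t] makes the terms tend to 0. As [Rpower t beta >= 1] there, the infinite
    product itself tends to 0 along the lattice, and this forces a zero on it. *)
Lemma q_laplace_power_scale (q beta s : R) : 0 < q < 1 -> 0 < beta -> 0 < s ->
  ex_q_laplace q (power_fun beta) s -> exists j : Z, (1 - q) * s = powerRZ q j.
Proof.
intros hq hb hs [_ hneg]; apply ex_series_lim_0 in hneg.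
assert (hqn : forall n, 0 < q ^ n) by (intros n; apply pow_lt; lra).
destruct (q_poch_inf_null_limit q ((1 - q) * s) hq) as [n [i h]].
- apply Rmult_lt_0_compat; lra.
- apply is_lim_seq_abs_0; apply is_lim_seq_le_le with (3 := proj1 (is_lim_seq_abs_0 _) hneg)
    (u := fun _ => 0); [|apply is_lim_seq_const].
  intros n; split; [apply Rabs_pos|].
  unfold jackson_improper_term, q_laplace_integrand, power_fun.
  (* The negative half starts at index -1, whence [S n]; the [q] inside [q_exp] absorbs one power,
     leaving the product at [(1 - q) * s * / q ^ n]. *)
  rewrite powerRZ_neg', <- pow_powerRZ by lra; set (t := / q ^ S n).
  assert (ht : 1 <= t).
  { unfold t; rewrite <- Rinv_1; apply Rinv_le_contravar; [apply hqn|].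
    rewrite <- (pow1 (S n)); apply pow_incr; lra. }
  replace (q_exp q (- (q * s * t))) with (q_poch_inf q ((1 - q) * s * / q ^ n)).
  2:{ rewrite q_poch_inf_q_exp by exact hq; f_equal; unfold t.
      assert (h := hqn n); simpl; field; lra. }
  replace (t * (q_poch_inf q ((1 - q) * s * / q ^ n) * Rpower t (beta - 1)))
    with (Rpower t beta * q_poch_inf q ((1 - q) * s * / q ^ n)).
  2:{ rewrite (Rpower_pred t beta) by lra; ring. }
  rewrite Rabs_mult, <- (Rmult_1_l (Rabs (q_poch_inf _ _))) at 1.
  apply Rmult_le_compat_r; [apply Rabs_pos|].
  rewrite Rabs_pos_eq by (apply Rlt_le, exp_pos).
  rewrite <- (Rpower_O t) by lra; apply Rle_Rpower; lra.
- exists (Z.of_nat n - Z.of_nat i)%Z.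
  unfold Z.sub; rewrite powerRZ_add, powerRZ_neg', <- !pow_powerRZ by lra.
  assert (h1 := hqn n); assert (h2 := hqn i).
  apply Rmult_eq_reg_r with (/ q ^ n * q ^ i).
  + rewrite <- Rmult_assoc, h; field; lra.
  + apply Rgt_not_eq, Rmult_lt_0_compat; [now apply Rinv_0_lt_compat|exact h2].
Qed.

(** Below index [- j] the [q]-exponential vanishes. Writing the index as [n - j] turns its exponent
    [m + j + 1] into [n + 1]. With [phi] arbitrary, this serves all three transforms. *)
Lemma is_bilateral_series_q_laplace (q s : R) (j : Z) (phi : R -> R) (l : R) :
  0 < q < 1 -> (1 - q) * s = powerRZ q j ->
  is_bilateral_series (jackson_improper_term q (q_laplace_integrand q phi s)) l <->
  is_series (fun n : nat => q ^ n * powerRZ q (- j) *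
    (q_poch_inf q (q * q ^ n) * phi (q ^ n * powerRZ q (- j)))) l.
Proof.
intros hq hj; rewrite (is_bilateral_series_from _ l (- j)).
- split; apply is_series_ext; intros n;
    unfold jackson_improper_term, q_laplace_integrand;
    rewrite (q_exp_powerRZ q s j), powerRZ_of_nat_add by (lra || exact hj);
    replace (Z.of_nat n + - j + j + 1)%Z with (Z.of_nat (S n)) by lia;
    now rewrite <- pow_powerRZ.
- intros n hn; unfold jackson_improper_term, q_laplace_integrand.
  rewrite (q_exp_powerRZ q s j), q_poch_inf_powerRZ_nonpos by (exact hj || lia || lra).
  ring.
Qed.

(** * Evaluation of the Cauchy product and the convolution theorem *)

Lemma cauchy_coef_q_poch_inf (q x K : R) (W C : nat -> R) : 0 < q < 1 ->
  (forall k, Rabs (C k - 1) <= K * q ^ k) ->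
  (forall n, (1 - q ^ S n) * W (S n) = x * W n) ->
  (forall k, (1 - q ^ S k) * C (S k) = (1 - x * q ^ k) * C k) ->
  ex_series (fun n => Rabs (W n)) ->
  forall m, cauchy_coef W C m = q_poch_inf q (q * q ^ m) * Series W.
Proof.
intros hq hCK hW hC hWs.
assert (hne : forall m : nat, q_poch_inf q (q * q ^ m) <> 0).
{ intros m; apply q_poch_inf_neq_0; [exact hq|]; assert (h := one_minus_pow_pos q m hq).
  simpl in h; lra. }
(* Equal first-order recurrences make the two sequences proportional; [c] is their ratio at 0,
   identified below by comparing limits. *)
set (c := cauchy_coef W C 0 / q_poch_inf q (q * q ^ 0)).
assert (hc : forall m, cauchy_coef W C m = c * q_poch_inf q (q * q ^ m)).
{ induction m as [|m IH]; [unfold c; field; apply hne|].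
  assert (h := one_minus_pow_pos q m hq).
  apply Rmult_eq_reg_l with (1 - q ^ S m); [|lra].
  rewrite (cauchy_coef_step q x W C m hW hC), IH, (q_poch_inf_step q (q * q ^ m) hq).
  replace (q * q ^ m * q) with (q * q ^ S m) by (simpl; ring); simpl; ring. }
assert (hlim := is_lim_seq_cauchy_coef q K C hq hCK W hWs).
assert (hlim' : is_lim_seq (cauchy_coef W C) (c * 1)).
{ apply is_lim_seq_ext with (fun m => c * q_poch_inf q (q * q ^ m)); [easy|].
  apply (is_lim_seq_scal_l _ c 1); now apply is_lim_seq_q_poch_inf. }
assert (e : Series W = c * 1).
{ apply is_lim_seq_unique in hlim; apply is_lim_seq_unique in hlim'.
  rewrite hlim in hlim'; now injection hlim'. }
intros m; rewrite hc, e; ring.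
Qed.

Theorem theorem6 (q beta : R) (a alpha : nat -> R) (f : R -> R) (s : R)
  (hq : 0 < q < 1)
  (hbeta : 0 < beta)
  (halpha : forall i : nat, 0 < alpha i)
  (hf : forall t : R, 0 < t ->
    is_series (fun i : nat => a i * Rpower t (alpha i)) (f t))
  (hs : 0 < s)
  (hLf : ex_q_laplace q f s)
  (hLg : ex_q_laplace q (power_fun beta) s)
  (hLfg : ex_q_laplace q (q_conv q f beta) s) :
  q_laplace q (q_conv q f beta) s
  = q_laplace q f s * q_laplace q (power_fun beta) s.
Proof.
destruct (q_laplace_power_scale q beta s hq hbeta hs hLg) as [j hj].
apply bilateral_series_correct in hLf; apply bilateral_series_correct in hLg.
unfold q_laplace, jackson_improper.
set (Lf := bilateral_series (jackson_improper_term q (q_laplace_integrand q f s))) in *.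
set (Lg := bilateral_series
  (jackson_improper_term q (q_laplace_integrand q (power_fun beta) s))) in *.
rewrite (is_bilateral_series_q_laplace q s j) in hLf, hLg by assumption.
set (t := fun n : nat => q ^ n * powerRZ q (- j)).
set (x := Rpower q beta).
assert (hqn : forall n : nat, 0 < q ^ n) by (intros n; apply pow_lt; lra).
assert (hx : 0 < x < 1) by now apply Rpower_lt_1.
assert (ht0 : 0 < powerRZ q (- j)) by (apply powerRZ_lt; lra).
assert (ht : forall n, 0 < t n) by (intros n; apply Rmult_lt_0_compat; auto).
set (F := fun n => t n * f (t n)).
set (W := fun n => q_poch_inf q (q * q ^ n) * Rpower (t n) beta).
set (C := fun k => q_poch_inf q (q * q ^ k) / q_poch_inf q (x * q ^ k)).
assert (hP : forall n : nat, q_poch_inf q (q * q ^ n) <> 0).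
{ intros n; apply q_poch_inf_neq_0; [exact hq|]; assert (h := one_minus_pow_pos q n hq).
  simpl in h; lra. }
assert (hPx : forall n : nat, q_poch_inf q (x * q ^ n) <> 0).
{ intros n; apply q_poch_inf_neq_0; [exact hq|]; assert (h := pow_le_1 q n hq); nra. }
assert (htx : forall n, Rpower (t n) beta = x ^ n * Rpower (powerRZ q (- j)) beta).
{ intros n; unfold t; rewrite <- Rpower_mult_distr by auto; now rewrite Rpower_pow_base by lra. }
assert (hFP : is_series (fun n => F n * q_poch_inf q (q * q ^ n)) Lf).
{ apply is_series_ext with (2 := hLf); intros n; unfold F, t; simpl; ring. }
assert (hWs : is_series W Lg).
{ apply is_series_ext with (2 := hLg); intros n; unfold W, power_fun; fold (t n).
  rewrite (Rpower_pred (t n) beta) by auto; simpl; ring. }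
(* Convergence is known for [F] times the infinite product. Multiplying by its inverse, written as a
   ratio with numerator parameter 0, keeps it by [ex_series_weighted]; the [0 +] fits that lemma. *)
assert (hF : ex_series F).
{ destruct (q_poch_inf_ratio_geom_error q q 0 hq ltac:(lra)) as [K [hK0 hK]].
  apply (ex_series_ext (fun k => F (0 + k)%nat * q_poch_inf q (q * q ^ (0 + k))
    * (q_poch_inf q (0 * q ^ (0 + k)) / q_poch_inf q (q * q ^ (0 + k))))).
  - intros n; rewrite Rmult_0_l, q_poch_inf_0 by exact hq; simpl; field; apply hP.
  - apply (ex_series_weighted q K (fun k => F k * q_poch_inf q (q * q ^ k))
      (fun k => q_poch_inf q (0 * q ^ k) / q_poch_inf q (q * q ^ k))); auto.
    now exists Lf. }
(* Domination by a multiple of [x ^ n], where [x < 1] because [beta > 0]. *)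
assert (hWabs : ex_series (fun n => Rabs (W n))).
{ destruct (is_lim_seq_bounded _ _ (is_lim_seq_q_poch_inf q q hq)) as [B [hB0 hB]].
  apply (ex_series_le (V := R_CompleteNormedModule) _
    (fun n => B * Rpower (powerRZ q (- j)) beta * x ^ n)).
  - intros n; change norm with Rabs; rewrite Rabs_Rabsolu; unfold W; rewrite Rabs_mult.
    rewrite (Rabs_pos_eq (Rpower _ _)) by (apply Rlt_le, exp_pos).
    rewrite htx; replace (B * Rpower (powerRZ q (- j)) beta * x ^ n)
      with (B * (x ^ n * Rpower (powerRZ q (- j)) beta)) by ring.
    apply Rmult_le_compat_r; [|apply hB].
    apply Rmult_le_pos; [apply pow_le; lra|apply Rlt_le, exp_pos].
  - apply (ex_series_scal (V := R_NormedModule) (B * Rpower (powerRZ q (- j)) beta)).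
    exists (/ (1 - x)); apply is_series_geom; rewrite Rabs_pos_eq; lra. }
destruct (q_poch_inf_ratio_geom_error q x q hq ltac:(lra)) as [K [hK0 hK]].
fold C in hK; change (forall k, Rabs (C k - 1) <= K * q ^ k) in hK.
assert (hcauchy : forall m, cauchy_coef W C m = q_poch_inf q (q * q ^ m) * Lg).
{ rewrite <- (is_series_unique _ _ hWs); apply cauchy_coef_q_poch_inf with x K; auto.
  - intros n; unfold W; rewrite !htx, (q_poch_inf_step q (q * q ^ n) hq).
    replace (q * q ^ n * q) with (q * q ^ S n) by (simpl; ring); simpl; ring.
  - intros k; unfold C; rewrite (q_poch_inf_step q (q * q ^ k) hq).
    (* [hk] is put back in the goal so that the rewriting factors it too; it then shows
       [1 - x * q ^ k] nonzero, as [field] requires. *)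
    assert (hk := hPx k); assert (hk' := hPx (S k)); revert hk.
    rewrite (q_poch_inf_step q (x * q ^ k) hq).
    replace (q * q ^ k * q) with (q * q ^ S k) by (simpl; ring).
    replace (x * q ^ k * q) with (x * q ^ S k) by (simpl; ring).
    intros hk; change (q * q ^ k) with (q ^ S k); field; split; [exact hk'|].
    intros e; apply hk; rewrite e; ring. }
assert (hfubini : is_series (fun n => W n * Series (fun k => F (n + k)%nat * C k)) (Lf * Lg)).
{ apply is_series_cauchy_coef_exchange with q K; auto.
  apply is_series_ext with (fun m => Lg * (F m * q_poch_inf q (q * q ^ m))).
  - intros m; rewrite hcauchy; simpl; ring.
  - rewrite (Rmult_comm Lf); now apply (is_series_scal (V := R_NormedModule) Lg). }
(* The extra [1 - q] comes from the Jackson integral inside the convolution and matches the second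
   prefactor on the right. *)
rewrite (is_bilateral_series_unique _ ((1 - q) * (Lf * Lg))); [ring|].
apply (is_bilateral_series_q_laplace q s j); [exact hq|exact hj|].
apply is_series_ext with (2 := is_series_scal (V := R_NormedModule) (1 - q) _ _ hfubini).
intros n; change (scal ?u ?v) with (u * v); fold (t n).
(* The nodes [q ^ k * t n] are the lattice points [t (n + k)], and the ratio in the shifted power
   depends on [k] alone, as [C k]. *)
assert (hconv : q_conv q f beta (t n)
  = (1 - q) * (Rpower (t n) (beta - 1) * Series (fun k => F (n + k)%nat * C k))).
{ unfold q_conv, jackson_int; f_equal; rewrite <- Series_scal_l; apply Series_ext.
  intros k; unfold q_shifted_power, F, C.
  replace (t (n + k)%nat) with (q ^ k * t n) by (unfold t; rewrite pow_add; ring).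
  replace (beta - 1 + 1) with beta by ring; fold x.
  replace (q * (q ^ k * t n) / t n) with (q * q ^ k) by (field; apply Rgt_not_eq, ht).
  replace (x * (q ^ k * t n) / t n) with (x * q ^ k) by (field; apply Rgt_not_eq, ht).
  unfold Rdiv; ring. }
rewrite hconv; unfold W; rewrite (Rpower_pred (t n) beta) by auto; simpl; ring.
Qed.
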